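(* Let $n\ge1$, let $k$ be a nonnegative integer and let $C\subseteq C^n$. The following four conditions are equivalent: (1) $C$ is a $k$-subcube of $C^n$; (2) $|C|=2^k$ and $\dim(\mathrm{aff}(C))=k$; (3) $C$ is a flat of $M(C^n)$ of rank $k+1$ having the maximum number of elements among flats of rank $k+1$; (4) $C=C(\mathbf v;I_1,\dots,I_k)$ for some vertex $\mathbf v\in C^n$ and some pairwise disjoint nonempty subsets $I_1,\dots,I_k$ of $[n]$.
   Context: $C^n=\{-1,1\}^n\subseteq\mathbb R^n$, $[n]=\{1,\dots,n\}$. $M(C^n)$ is the matroid of affine dependencies of $C^n$ over $\mathbb R$ (independent sets = affinely independent subsets); the rank of $A\subseteq C^n$ is $\dim(\mathrm{aff}(A))+1$. A $k$-subcube of $C^n$ is a subset $C\subseteq C^n$ whose matroid of affine dependencies over $\mathbb R$ is isomorphic to $M(C^k)$. For $\mathbf v\in C^n$ and $I\subseteq[n]$, $\mathbf v(I)\in\mathbb R^n$ is the vector obtained from $\mathbf v$ by replacing by $0$ the entries indexed by $[n]\setminus I$. For pairwise disjoint nonempty $I_1,\dots,I_k\subseteq[n]$ and $J=[n]\setminus(I_1\cup\dots\cup I_k)$, $C(\mathbf v;I_1,\dots,I_k)=\{\epsilon_1\mathbf v(I_1)+\dots+\epsilon_k\mathbf v(I_k)+\mathbf v(J):\epsilon_1,\dots,\epsilon_k\in\{-1,1\}\}$. *)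

(* Defs.v *)
From HB Require Import structures.
From mathcomp Require Import all_boot all_order all_algebra.
From mathcomp Require Import finmap.
From mathcomp Require Import boolp classical_sets reals.

Set Implicit Arguments.
Unset Strict Implicit.
Unset Printing Implicit Defensive.

Import Order.TTheory GRing.Theory Num.Theory.

Local Open Scope fset_scope.
Local Open Scope ring_scope.

Record matroid (T : choiceType) := Matroid {
  ground : {fset T};
  indep : {fset T} -> Prop;
  indep_ground : forall A, indep A -> A `<=` ground;
  indep0 : indep fset0;
  indepS : forall A B, A `<=` B -> indep B -> indep A;
  indep_augment : forall A B, indep A -> indep B -> (#|` A| < #|` B|)%N ->
    exists2 x, x \in B `\` A & indep (x |` A)
}.

Definition matroid_iso (T U : choiceType) (M : matroid T) (N : matroid U) :
    Prop :=
  exists f : T -> U,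
    [/\ {in ground M &, injective f},
        [fset f x | x in ground M] = ground N &
        forall A, A `<=` ground M ->
          (indep M A <-> indep N [fset f x | x in A])].

Definition rank (T : choiceType) (M : matroid T) (X : {fset T}) : nat :=
  \max_(A <- fpowerset X | `[< indep M A >]) #|` A|.

Definition flat (T : choiceType) (M : matroid T) (F : {fset T}) : Prop :=
  F `<=` ground M /\
  forall x, x \in ground M `\` F -> (rank M F < rank M (x |` F))%N.

Definition affinely_indep (R : fieldType) (V : vectType R) (A : {fset V}) :
    Prop :=
  forall c : V -> R,
    \sum_(v <- A) c v = 0 -> \sum_(v <- A) c v *: v = 0 ->
    forall v, v \in A -> c v = 0.

Definition affhull (R : fieldType) (V : vectType R) (A : {fset V}) : set V :=
  [set x | exists2 c : V -> R,
     \sum_(v <- A) c v = 1 & x = \sum_(v <- A) c v *: v]%classic.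

Definition aff_direction (R : fieldType) (V : vectType R) (A : {fset V}) :
    {vspace V} :=
  <<[seq x - y | x <- enum_fset A, y <- enum_fset A]>>%VS.

(* The dimension of the affine hull of [A], with the usual convention that the
   empty hull has dimension -1. That [aff_direction A] is the direction of
   [affhull A] is [affhullE] below. *)
Definition affdim (R : fieldType) (V : vectType R) (A : {fset V}) : int :=
  if A == fset0 then -1 else (\dim (aff_direction A))%:Z.

Section Homogenization.
Variables (R : fieldType) (V : vectType R).
Implicit Types (A B : {fset V}) (s : seq V) (x y : V).

Let W : vectType R := (R^o * V)%type.
Definition homog x : W := (1, x).

Lemma homog_sum s (c : V -> R) :
  \sum_(v <- s) c v *: homog v = (\sum_(v <- s) c v, \sum_(v <- s) c v *: v).
Proof.
elim: s => [|v s IH]; first by rewrite !big_nil.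
rewrite !big_cons IH; apply: injective_projections => //=.
by rewrite /GRing.scale /= mulr1.
Qed.

Lemma span_homogP s (w : W) : uniq s -> w \in <<map homog s>>%VS ->
  exists c : V -> R, w = \sum_(v <- s) c v *: homog v.
Proof.
elim: s w => [|v s IH] w /=.
  by rewrite span_nil memv0 => _ /eqP ->; exists (fun=> 0); rewrite big_nil.
case/andP=> vs us; rewrite span_cons => /memv_addP[a /vlineP[k ->]].
move=> [b /(IH _ us)[c ->] ->].
exists (fun x => if x == v then k else c x); rewrite big_cons eqxx; congr (_ + _).
by apply: eq_big_seq => x xs; case: eqP => // xv; rewrite -xv xs in vs.
Qed.

Lemma free_homogP s : uniq s -> free (map homog s) <->
  (forall c : V -> R, \sum_(v <- s) c v = 0 -> \sum_(v <- s) c v *: v = 0 ->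
    forall v, v \in s -> c v = 0).
Proof.
elim: s => [|v s IH] /=; first by split=> // _; rewrite nil_free.
case/andP=> vs us; have {IH} IH := IH us; rewrite free_cons; split.
  case/andP=> vsp /IH fs c.
  rewrite !big_cons => e1 e2.
  have e : c v *: homog v = - \sum_(x <- s) c x *: homog x.
    apply/eqP; rewrite -addr_eq0; have := homog_sum (v :: s) c.
    by rewrite !big_cons e1 e2 => ->.
  have cv0 : c v = 0.
    apply/eqP; apply: contraNT vsp => cv0.
    rewrite -[homog v](scalerK cv0) e rpredZ //= rpredN.
    rewrite big_seq rpred_sum // => x xs.
    by rewrite rpredZ //= memv_span // map_f.
  move=> x; rewrite inE => /orP[/eqP -> //|xs].
  move: e1 e2; rewrite cv0 scale0r !add0r => e1 e2.
  exact: (fs c e1 e2 x xs).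
move=> H; apply/andP; split.
  apply/negP => /(span_homogP us)[c]; rewrite homog_sum => -[e1 e2].
  pose d x := if x == v then -1 else c x.
  have dE x : x \in s -> d x = c x.
    by rewrite /d; case: eqP => // -> xs; rewrite xs in vs.
  have dv : d v = -1 by rewrite /d eqxx.
  suff : d v = 0 by rewrite dv => /eqP; rewrite oppr_eq0 oner_eq0.
  apply: (H d) (mem_head _ _); rewrite big_cons dv.
    by rewrite (eq_big_seq c) // -e1 addNr.
  rewrite (eq_big_seq (fun x => c x *: x)) => [|x /dE ->//].
  by rewrite -e2 scaleN1r addNr.
apply/IH => c e1 e2 x xs.
pose d y := if y == v then 0 else c y.
have dE y : y \in s -> d y = c y.
  by rewrite /d; case: eqP => // -> ys; rewrite ys in vs.
have dv : d v = 0 by rewrite /d eqxx.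
rewrite -dE //; apply: (H d); last by rewrite inE xs orbT.
  by rewrite big_cons dv add0r (eq_big_seq c).
rewrite big_cons dv scale0r add0r.
by rewrite (eq_big_seq (fun y => c y *: y)) // => y /dE ->.
Qed.

Definition hspan A : {vspace W} := <<map homog A>>%VS.

Lemma affinely_indepP A : affinely_indep A <-> free (map homog A).
Proof. by split=> H; apply/(free_homogP (fset_uniq A)). Qed.

Lemma affinely_indep_dim A : affinely_indep A -> \dim (hspan A) = #|` A|.
Proof. by move/affinely_indepP/eqP; rewrite size_map. Qed.

Lemma perm_fset1U x A : x \notin A -> perm_eq (x |` A) (x :: A).
Proof.
move=> xA; apply: uniq_perm => [||y]; rewrite ?fset_uniq //=.
  by rewrite xA fset_uniq.
by rewrite !inE.
Qed.

Lemma affinely_indep1U x A : x \notin A ->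
  affinely_indep (x |` A) <->
  homog x \notin hspan A /\ affinely_indep A.
Proof.
move=> xA; rewrite !affinely_indepP.
rewrite (perm_free (perm_map homog (perm_fset1U xA))) /= free_cons.
by split=> [/andP|H]//; apply/andP.
Qed.

Lemma affinely_indep0 : affinely_indep (fset0 : {fset V}).
Proof. by move=> c _ _ v; rewrite inE. Qed.

Lemma affinely_indepS A B : A `<=` B -> affinely_indep B -> affinely_indep A.
Proof.
move=> AB /affinely_indepP fB; apply/affinely_indepP.
have p : perm_eq A [seq x <- B | x \in A].
  apply: uniq_perm; rewrite ?filter_uniq ?fset_uniq // => x.
  rewrite mem_filter; case xA: (x \in A) => //=.
  by rewrite (fsubsetP AB).
rewrite (perm_free (perm_map homog p)).
rewrite (_ : map _ _ = [seq w <- map homog B | w.2 \in A]) ?filter_free //.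
by rewrite filter_map.
Qed.

Lemma affinely_indep_augment A B :
  affinely_indep A -> affinely_indep B -> (#|` A| < #|` B|)%N ->
  exists2 x, x \in B `\` A & affinely_indep (x |` A).
Proof.
move=> iA iB ltAB; apply: contrapT => H.
suff : (hspan B <= hspan A)%VS.
  by move/dimvS; rewrite !affinely_indep_dim // leqNgt ltAB.
apply/span_subvP => _ /mapP[x xB ->].
have [xA|xA] := boolP (x \in A); first by rewrite memv_span ?map_f.
apply: contraT => nx; case: H; exists x; first by rewrite inE xA.
exact/affinely_indep1U.
Qed.

Lemma affhullP A x : affhull A x <-> homog x \in hspan A.
Proof.
split=> [[c e1 e2]|/(span_homogP (fset_uniq A))[c]]; last first.
  by rewrite homog_sum => -[e1 e2]; exists c.
have -> : homog x = \sum_(v <- A) c v *: homog v by rewrite homog_sum e1 -e2.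
by rewrite big_seq rpred_sum // => v vA; rewrite rpredZ //= memv_span // map_f.
Qed.

Definition vecpart (u : V) : W := (0, u).

Lemma vecpart_is_linear : linear vecpart.
Proof. by move=> k u v; apply: injective_projections; rewrite //= scaler0 addr0. Qed.

HB.instance Definition _ :=
  GRing.isLinear.Build R V W *:%R vecpart vecpart_is_linear.

Lemma vecpart_ker : lker (linfun vecpart) == 0%VS.
Proof. by apply/lker0P => u v; rewrite !lfunE /= => -[]. Qed.

Lemma hspanE A x : x \in A ->
  hspan A = (<[homog x]> + linfun vecpart @: aff_direction A)%VS.
Proof.
move=> xA; apply/eqP; rewrite eqEsubv; apply/andP; split.
  apply/span_subvP => _ /mapP[v vA ->].
  have -> : homog v = homog x + linfun vecpart (v - x).
    by rewrite lfunE /=; apply: injective_projections; rewrite /= ?addr0 // addrC subrK.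
  rewrite memv_add ?memv_line // memv_img // memv_span //.
  by apply/allpairsP; exists (v, x).
rewrite subv_add -memvE memv_span ?map_f //= limg_span.
apply/span_subvP => _ /mapP[_ /allpairsP[[v w] [/= vA wA ->]] ->].
have -> : linfun vecpart (v - w) = homog v - homog w.
  by rewrite lfunE /=; apply: injective_projections; rewrite /= ?subrr //.
by rewrite rpredB // memv_span // map_f.
Qed.

Lemma vecpart_hspan A u : A != fset0 ->
  (vecpart u \in hspan A) = (u \in aff_direction A).
Proof.
case/fset0Pn=> x xA; rewrite (hspanE xA); apply/idP/idP => [|uD]; last first.
  rewrite (subvP (addvSr _ _)) //.
  by rewrite -[vecpart u]/(vecpart u) -(lfunE vecpart) memv_img.
case/memv_addP=> _ /vlineP[k ->] [_ /memv_imgP[w wD ->]].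
rewrite lfunE /= => -[e1 e2].
have k0 : k = 0 by rewrite e1 /GRing.scale /= mulr1 addr0.
by rewrite e2 k0 scale0r add0r.
Qed.

Lemma affhullE A x : affhull A x ->
  affhull A = [set x + u | u in [set` aff_direction A]]%classic.
Proof.
move=> hx; have A0 : A != fset0.
  apply/eqP => A0; case: hx => c; rewrite A0 big_seq_fset0 => /eqP.
  by rewrite eq_sym oner_eq0.
have {}hx := (affhullP A x).1 hx.
have hE u : (homog (x + u) \in hspan A) = (u \in aff_direction A).
  have -> : homog (x + u) = homog x + vecpart u.
    by apply: injective_projections; rewrite /= ?addr0.
  by rewrite (rpredDl _ hx) vecpart_hspan.
apply/seteqP; split => [y /affhullP hy|_ [u uD <-]].
  by exists (y - x); rewrite /= ?[_ + (y - x)]addrC ?subrK // -hE addrC subrK.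
by apply/affhullP; rewrite hE.
Qed.

Lemma dim_hspan A : (\dim (hspan A))%:Z = affdim A + 1.
Proof.
rewrite /affdim; case: ifPn => [/eqP ->|A0].
  by rewrite /hspan (size0nil (cardfs0 V)) /= span_nil dimv0.
have /fset0Pn[x xA] := A0.
rewrite (hspanE xA) dimv_disjoint_sum.
  rewrite dim_vline limg_dim_eq; last by rewrite (eqP vecpart_ker) capv0.
  have -> : homog x != 0 by apply/eqP => -[/eqP]; rewrite oner_eq0.
  by rewrite PoszD addrC.
apply/eqP; rewrite -subv0; apply/subvP => w.
rewrite memv_cap => /andP[/vlineP[k ->] /memv_imgP[u _]].
rewrite lfunE /= => -[]; rewrite /GRing.scale /= mulr1 => -> _.
by rewrite memv0; apply/eqP; apply: injective_projections; rewrite /= ?mul0r ?scale0r.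
Qed.

End Homogenization.

(* The matroid of affine dependencies of a finite set of points. *)
Section AffineMatroid.
Variables (R : fieldType) (V : vectType R) (E : {fset V}).

Let aindep (A : {fset V}) : Prop := A `<=` E /\ affinely_indep A.

Fact aff_matroid_ground A : aindep A -> A `<=` E.
Proof. by case. Qed.

Fact aff_matroid0 : aindep fset0.
Proof. by split; [exact: fsub0set|exact: affinely_indep0]. Qed.

Fact aff_matroidS A B : A `<=` B -> aindep B -> aindep A.
Proof.
move=> AB [BE iB]; split; first exact: fsubset_trans BE.
exact: affinely_indepS iB.
Qed.

Fact aff_matroid_augment A B : aindep A -> aindep B -> (#|` A| < #|` B|)%N ->
  exists2 x, x \in B `\` A & aindep (x |` A).
Proof.
move=> [AE iA] [BE iB] /(affinely_indep_augment iA iB)[x xBA ixA].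
exists x => //; split=> //; rewrite fsubUset AE fsub1set andbT.
by apply: (fsubsetP BE); move: xBA; rewrite inE => /andP[].
Qed.

Definition aff_matroid : matroid V :=
  @Matroid V E (fun A => A `<=` E /\ affinely_indep A) aff_matroid_ground
    aff_matroid0 aff_matroidS aff_matroid_augment.

Lemma rank_aff_matroid (A : {fset V}) : A `<=` E ->
  (rank aff_matroid A)%:Z = affdim A + 1.
Proof.
move=> AE; rewrite -dim_hspan; congr Posz; apply/eqP.
rewrite eqn_leq; apply/andP; split.
  apply/bigmax_leqP_seq => B; rewrite fpowersetE => BA /asboolP[_ iB].
  rewrite -(affinely_indep_dim iB) dimvS // sub_span // => _ /mapP[v vB ->].
  by rewrite map_f // (fsubsetP BA).
pose P m := `[< exists B : {fset V}, [/\ B `<=` A, affinely_indep B & #|` B| = m] >].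
have exP : exists m, P m.
  exists 0%N; apply/asboolP; exists fset0; split.
  - exact: fsub0set.
  - exact: affinely_indep0.
  - exact: cardfs0.
have ubP m : P m -> (m <= #|` A|)%N.
  by move=> /asboolP[B [BA _ <-]]; exact: fsubset_leq_card.
case: (ex_maxnP exP ubP) => m /asboolP[B [BA iB eB]] maxm.
have : (hspan A <= hspan B)%VS.
  apply/span_subvP => _ /mapP[v vA ->].
  have [vB|vB] := boolP (v \in B); first by rewrite memv_span ?map_f.
  apply: contraT => nv; suff : (m.+1 <= m)%N by rewrite ltnn.
  apply: maxm; apply/asboolP; exists (v |` B); split.
  - by rewrite fsubUset fsub1set vA.
  - exact/affinely_indep1U.
  - by rewrite cardfsU1 vB eB.
move/dimvS/leq_trans; apply; rewrite affinely_indep_dim //.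
rewrite /rank; apply: (@leq_bigmax_seq _ _ _ (fun B : {fset V} => #|` B|) B).
  by rewrite fpowersetE.
by apply/asboolP; split=> //; exact: fsubset_trans AE.
Qed.

End AffineMatroid.

Definition cube_vertex (R : realType) (n : nat) (e : {ffun 'I_n -> bool}) :
    'rV[R]_n :=
  \row_(i < n) (-1) ^+ e i.

Definition cube (R : realType) (n : nat) : {fset 'rV[R]_n} :=
  [fset cube_vertex R e | e : {ffun 'I_n -> bool}].

Lemma in_cube (R : realType) n (v : 'rV[R]_n) :
  (v \in cube R n) = [forall i, (v 0 i == 1) || (v 0 i == -1)].
Proof.
apply/imfsetP/forallP => /= [[e _ -> i]|H].
  by rewrite mxE; case: (e i); rewrite ?expr1 ?expr0 eqxx ?orbT.
exists [ffun i => v 0 i == -1] => //; apply/rowP => i.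
rewrite mxE ffunE; case: eqP => [->//|/eqP ne].
by have := H i; rewrite (negPf ne) orbF => /eqP ->.
Qed.

Definition is_subcube (R : realType) (n k : nat) (C : {fset 'rV[R]_n}) : Prop :=
  C `<=` cube R n /\ matroid_iso (aff_matroid C) (aff_matroid (cube R k)).

Definition restr (R : realType) (n : nat) (v : 'rV[R]_n) (I : {set 'I_n}) :
    'rV[R]_n :=
  \row_(i < n) (if i \in I then v 0 i else 0).

Definition signed_sum (R : realType) (n k : nat) (v : 'rV[R]_n)
    (I : 'I_k -> {set 'I_n}) (eps : 'rV[R]_k) : 'rV[R]_n :=
  \sum_(j < k) eps 0 j *: restr v (I j)
  + restr v (~: \bigcup_(j < k) I j)%SET.

Definition signed_cube (R : realType) (n k : nat) (v : 'rV[R]_n)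
    (I : 'I_k -> {set 'I_n}) : {fset 'rV[R]_n} :=
  [fset signed_sum v I eps | eps in cube R k].

(* Main.v *)
(** The direction space of a set [A] of cube vertices, of dimension [m] say, is
    determined by [m] of its coordinates, so that projecting onto these embeds
    [A] into the [m]-cube: hence [#|A| <= 2 ^ m], which makes a set attaining
    the bound a flat of maximal size.  In the case of equality the projection is
    onto, and every other coordinate is an affine function on the whole
    [m]-cube with values in {-1, 1}; such a function is constant or depends, up
    to sign, on a single variable.  The set [I j] consists of the coordinates
    depending on the [j]th variable. *)
Require Import Defs.
From mathcomp Require Import all_boot all_order all_algebra.
From mathcomp Require Import finmap.
From mathcomp Require Import boolp classical_sets reals.

Import Order.TTheory GRing.Theory Num.Theory.
Local Open Scope fset_scope.
Local Open Scope ring_scope.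

Set Implicit Arguments.
Unset Strict Implicit.

(** * Vertices of the cube and coordinates on a subspace *)

Lemma card_cube (R : realType) (n : nat) : #|` cube R n| = (2 ^ n)%N.
Proof.
rewrite /cube card_imfset /=; last first.
  move=> d e /rowP de; apply/ffunP => i; have := de i.
  by rewrite !mxE => /signr_inj.
by rewrite -cardE card_ffun card_bool card_ord.
Qed.

Lemma cubeP (R : realType) (n : nat) (v : 'rV[R]_n) :
  reflect (forall i, v 0 i = 1 \/ v 0 i = -1) (v \in cube R n).
Proof.
rewrite in_cube; apply: (iffP forallP) => H i; have := H i.
  by case/orP => /eqP; [left|right].
by case=> ->; rewrite eqxx ?orbT.
Qed.

(** The matrix [B] of a basis of [D] has full row rank, so some [\dim D] of its columns form an
    invertible matrix. [f] selects these columns, and [M] is the inverse of that matrix times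
    [B]. *)
Lemma vspace_coordinates (F : fieldType) (n : nat) (D : {vspace 'rV[F]_n}) :
  exists (f : 'I_(\dim D) -> 'I_n) (M : 'M[F]_(\dim D, n)),
    forall u, u \in D -> u = colsub f u *m M.
Proof.
pose B := \matrix_(j < \dim D) (vbasis D)`_j.
have Bcomb (c : 'rV_(\dim D)) : c *m B = \sum_j c 0 j *: (vbasis D)`_j.
  by rewrite mulmx_sum_row; apply: eq_bigr => j _; rewrite rowK.
have Bfull : row_full B^T.
  rewrite -[row_full _]/(\rank B^T == _) mxrank_tr -[_ == _]/(row_free B).
  apply: inj_row_free => c; rewrite Bcomb => c0.
  apply/rowP => j; rewrite mxE.
  have fB : free (vbasis D) := basis_free (vbasisP D).
  exact: (elimT freeP fB (c 0) c0).
pose f := fullrankfun Bfull.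
have Qunit : colsub f B \in unitmx.
  have -> : colsub f B = (rowsub f B^T)^T by apply/matrixP => i j; rewrite !mxE.
  by rewrite unitmx_tr fullrowsub_unit.
exists f, (invmx (colsub f B) *m B) => u uD.
have -> : u = (\row_j coord (vbasis D) j u) *m B.
  rewrite Bcomb {1}(coord_vbasis uD).
  by apply: eq_bigr => j _; rewrite mxE.
by rewrite -mulmx_colsub mulmxA mulmxK.
Qed.

Lemma memv_aff_direction (F : fieldType) (V : vectType F) (A : {fset V}) x y :
  x \in A -> y \in A -> x - y \in aff_direction A.
Proof.
by move=> xA yA; rewrite memv_span //; apply/allpairsP; exists (x, y).
Qed.

Lemma colsub_cube (R : realType) (m n : nat) (f : 'I_m -> 'I_n) (x : 'rV[R]_n) :
  x \in cube R n -> colsub f x \in cube R m.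
Proof. by move/cubeP=> xc; apply/cubeP => j; rewrite mxE. Qed.

(** * Projecting a set of vertices onto a smaller cube *)

Section SubsetsOfTheCube.
Variables (R : realType) (n : nat) (A : {fset 'rV[R]_n}).
Hypothesis Acube : A `<=` cube R n.
Variables (m : nat) (f : 'I_m -> 'I_n) (M : 'M[R]_(m, n)).
Hypothesis fM : forall u, u \in aff_direction A -> u = colsub f u *m M.

Lemma colsub_inj : {in A &, injective (fun x => colsub f x)}.
Proof.
move=> x y xA yA xy; apply/eqP; rewrite -subr_eq0; apply/eqP.
rewrite (fM (memv_aff_direction xA yA)).
have -> : colsub f (x - y) = colsub f x - colsub f y.
  by apply/rowP => j; rewrite !mxE.
by rewrite xy subrr mul0mx.
Qed.

Lemma colsub_image : [fset colsub f x | x in A] `<=` cube R m.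
Proof.
apply/fsubsetP => _ /imfsetP[x /= xA ->].
by apply: colsub_cube; apply: (fsubsetP Acube).
Qed.

Lemma leq_card_coords : (#|` A| <= 2 ^ m)%N.
Proof.
have := fsubset_leq_card colsub_image.
by rewrite card_cube card_in_imfset //; apply: colsub_inj.
Qed.

Lemma signed_cube_coords : #|` A| = (2 ^ m)%N ->
  exists (v : 'rV[R]_n) (I : 'I_m -> {set 'I_n}),
    [/\ v \in cube R n,
        forall j, I j != finset.set0,
        forall i j, i != j -> [disjoint I i & I j]%bool &
        A = signed_cube v I].
Proof.
move=> cardA.
have onto eps : eps \in cube R m -> exists2 x, x \in A & colsub f x = eps.
  have <- : [fset colsub f x | x in A] = cube R m.
    apply/eqP; rewrite eqEfcard colsub_image card_cube -cardA.
    by rewrite card_in_imfset //=; apply: colsub_inj.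
  by case/imfsetP => x xA ->; exists x.
(* With the base point [v] above the all-ones vertex, moving from [v] to any point of [A] changes
   each free coordinate by 0 or -2. *)
have [|v vA v1] := onto (const_mx 1); first by apply/cubeP => j; rewrite mxE; left.
have vcube := fsubsetP Acube v vA; have vP := cubeP _ vcube.
have xE x i : x \in A -> x 0 i = v 0 i + \sum_j (x 0 (f j) - 1) * M j i.
  move=> xA; have /rowP/(_ i) := fM (memv_aff_direction xA vA).
  rewrite !mxE => /eqP; rewrite subr_eq addrC => /eqP ->; congr (_ + _).
  apply: eq_bigr => j _; rewrite !mxE.
  by have /rowP/(_ j) := v1; rewrite !mxE => ->.
have vneq0 i : v 0 i != 0.
  by case: (vP i) => ->; rewrite ?oppr_eq0 oner_eq0.
(* Negating the free coordinates in [J], starting from [v], either fixes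
   coordinate [i] or negates it. *)
have flip (J : {set 'I_m}) i :
    \sum_(j in J) M j i = 0 \/ \sum_(j in J) M j i = v 0 i.
  have [|x xA xJ] := onto (\row_j (if j \in J then -1 else 1)).
    by apply/cubeP => j; rewrite mxE; case: ifP; [right|left].
  have := xE x i xA.
  have -> : \sum_j (x 0 (f j) - 1) * M j i = - 2 * \sum_(j in J) M j i.
    rewrite mulr_sumr [RHS]big_mkcond; apply: eq_bigr => j _.
    have /rowP/(_ j) := xJ; rewrite !mxE => ->.
    by case: ifP => _; rewrite ?subrr ?mul0r // -opprD.
  set S := \sum_(j in J) _ => e.
  have e2 : S *+ 2 = v 0 i - x 0 i.
    by rewrite e opprD addrA subrr sub0r mulNr opprK mulr_natl.
  have inj2 (a b : R) : a *+ 2 = b *+ 2 -> a = b.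
    by move/eqP; rewrite eqrMn2r => /eqP.
  have xc := cubeP _ (fsubsetP Acube x xA) i.
  case: (vP i) xc e2 => [->|->] [->|->] e2; [left|right|right|left]; apply: inj2.
  - by rewrite e2 subrr mul0rn.
  - by rewrite e2 opprK.
  - by rewrite e2 mulr2n.
  - by rewrite e2 subrr mul0rn.
have M1 j i : M j i != 0 -> M j i = v 0 i.
  by case: (flip [set j]%SET i); rewrite big_set1 => ->; rewrite ?eqxx.
(* Two nonzero entries in column [i] would both equal [v 0 i]; their sum would be twice [v 0 i],
   which [flip] excludes for [[set j; l]]. *)
have M2 j l i : j != l -> M j i != 0 -> M l i = 0.
  move=> jl Mj; apply/eqP; apply: contraT => Ml.
  have := flip [set j; l]%SET i; rewrite big_setU1 ?big_set1 ?inE //=.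
  rewrite (M1 _ _ Mj) (M1 _ _ Ml) -mulr2n => -[/eqP|/eqP].
    by rewrite mulrn_eq0 /= (negPf (vneq0 i)).
  by rewrite mulr2n -subr_eq0 addrK (negPf (vneq0 i)).
pose I j := [set i | M j i != 0]%SET.
have dI i j : i != j -> [disjoint I i & I j]%bool.
  move=> ij; apply/pred0P => l /=; rewrite !inE.
  by apply/negP => /andP[/(M2 _ _ _ ij) ->]; rewrite eqxx.
have sE x : x \in A -> x = signed_sum v I (colsub f x).
  move=> xA; apply/rowP => i; rewrite xE // /signed_sum !mxE summxE.
  have -> : \sum_j (x 0 (f j) - 1) * M j i =
     \sum_j x 0 (f j) * M j i - \sum_j M j i.
    by rewrite -sumrB; apply: eq_bigr => j _; rewrite mulrBl mul1r.
  have -> : \sum_j (colsub f x 0 j *: restr v (I j)) 0 i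
      = \sum_j x 0 (f j) * M j i.
    apply: eq_bigr => j _; rewrite !mxE inE.
    by case: eqP => [->//|/eqP/M1 ->].
  (* What remains is the constant term: column [i] of [M] sums to [v 0 i] if [i] lies in some block
     and to 0 otherwise. *)
  rewrite addrCA; congr (_ + _).
  rewrite inE; case: bigcupP => [[j _]|nI] /=.
    rewrite inE => Mj; rewrite (bigD1 j) //= big1 => [|l lj]; last first.
      by apply: M2 Mj; rewrite eq_sym.
    by rewrite addr0 (M1 _ _ Mj) subrr.
  rewrite big1 ?subr0 // => j _; apply/eqP; apply: contraT => Mj.
  by case: nI; exists j; rewrite ?inE.
exists v, I; split=> //.
  (* The block [I j] contains [f j] itself: if [M j (f j)] were 0, coordinate [f j] would keep its
     value 1 at the point of [A] where only the [j]th free coordinate is negated. *)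
  move=> j; apply/set0Pn; exists (f j); rewrite inE; apply/negP => /eqP Mj.
  have [|x xA xj] := onto (\row_l (if l == j then -1 else 1)).
    by apply/cubeP => l; rewrite mxE; case: ifP; [right|left].
  have := xE x (f j) xA.
  have /rowP/(_ j) := v1; have /rowP/(_ j) := xj; rewrite !mxE eqxx => -> ->.
  rewrite (bigD1 j) //= Mj mulr0 big1 ?addr0 => [/eqP|l lj].
    by rewrite eqNr oner_eq0.
  have /rowP/(_ l) := xj; rewrite !mxE (negPf lj) => ->.
  by rewrite subrr mul0r.
apply/fsetP => x; apply/idP/imfsetP => [xA|[eps /= /onto[y yA <-] ->]].
  exists (colsub f x); last exact: sE.
  by apply: colsub_cube; apply: (fsubsetP Acube).
by rewrite -sE.
Qed.

End SubsetsOfTheCube.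

(** * Rank and affine dimension *)

Lemma affdim_natP (F : fieldType) (V : vectType F) (A : {fset V}) (k : nat) :
  affdim A = k%:Z -> \dim (aff_direction A) = k.
Proof. by rewrite /affdim; case: eqP => // _ []. Qed.

Lemma leq_card_rank (R : realType) (n m : nat) (A : {fset 'rV[R]_n}) :
  A `<=` cube R n -> (rank (aff_matroid (cube R n)) A <= m.+1)%N ->
  (#|` A| <= 2 ^ m)%N.
Proof.
move=> Ac; have := rank_aff_matroid Ac; rewrite /affdim.
case: eqP => [->|_ e]; first by rewrite cardfs0.
have [f [M fM]] := vspace_coordinates (aff_direction A).
have -> : rank (aff_matroid (cube R n)) A = (\dim (aff_direction A)).+1.
  by apply/eqP; rewrite -eqz_nat e intS addrC.
rewrite ltnS => dm; apply: leq_trans (leq_card_coords Ac fM) _.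
by rewrite leq_pexp2l.
Qed.

(** Independent sets are carried to independent sets of the same size, forward by images and
    backward by preimages within the ground set. *)
Lemma rank_matroid_iso (T U : choiceType) (M : matroid T) (N : matroid U) :
  matroid_iso M N -> rank M (ground M) = rank N (ground N).
Proof.
case=> f [finj fimg find]; apply/eqP; rewrite eqn_leq; apply/andP; split.
  apply/bigmax_leqP_seq => A; rewrite fpowersetE => AM /asboolP iA.
  rewrite -(@card_in_imfset imfset_key _ _ f (mem A)); last first.
    by move=> x y xA yA; apply: finj; apply: (fsubsetP AM).
  apply: (@leq_bigmax_seq _ _ _ (fun B : {fset U} => #|` B|)).
    by rewrite fpowersetE; apply: indep_ground; apply/find.
  by apply/asboolP; apply/find.
apply/bigmax_leqP_seq => B; rewrite fpowersetE => BN /asboolP iB.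
pose A := [fset x in ground M | f x \in B].
have AM : A `<=` ground M by apply/fsubsetP => x; rewrite !inE => /andP[].
have AB : [fset f x | x in A] = B.
  apply/fsetP => y; apply/imfsetP/idP => /= [[x]|yB].
    by rewrite !inE => /andP[_ ?] ->.
  have : y \in ground N by apply: (fsubsetP BN).
  rewrite -fimg => /imfsetP[x /= xM yx]; exists x => //.
  by rewrite !inE xM -yx.
rewrite -AB card_in_imfset /=; last first.
  by move=> x y xA yA; apply: finj; apply: (fsubsetP AM).
apply: (@leq_bigmax_seq _ _ _ (fun B : {fset T} => #|` B|)).
  by rewrite fpowersetE.
by apply/asboolP; apply/find => //; rewrite AB.
Qed.

(** The ambient space gives the upper bound. The lower bound is by counting: a direction space of
    dimension [d] allows at most [2 ^ d] vertices, and there are [2 ^ k]. *)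
Lemma affdim_cube (R : realType) (k : nat) : affdim (cube R k) = k%:Z.
Proof.
have c0 : cube R k != fset0 by rewrite -cardfs_gt0 card_cube expn_gt0.
rewrite /affdim (negPf c0); congr Posz; apply/eqP; rewrite eqn_leq.
have dle : (\dim (aff_direction (cube R k)) <= 1 * k)%N.
  by apply: leq_trans (dimvS (subvf _)) _; rewrite dimvf.
apply/andP; split; first by apply: leq_trans dle _; rewrite mul1n.
have [f [M fM]] := vspace_coordinates (aff_direction (cube R k)).
have := leq_card_coords (fsubset_refl _) fM.
by rewrite card_cube leq_exp2l.
Qed.

(** An affine map carries a dependency to one with the same coefficients, transported along [h].
    Since [h] is any left inverse on [A], the lemma serves both directions of a matroid
    isomorphism. *)
Lemma affinely_indep_preimage (F : fieldType) (V W : vectType F)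
    (L : {linear V -> W}) (w : W) (h : W -> V) (A : {fset V}) :
  {in A, cancel (fun x => L x + w) h} ->
  affinely_indep [fset L x + w | x in A] -> affinely_indep A.
Proof.
set g := fun x => L x + w => gK gA c c0 c1 x xA.
have ginj : {in A &, injective g} by exact: can_in_inj gK.
rewrite -(gK x xA); apply: (gA (c \o h)).
- rewrite big_imfset //= -[RHS]c0.
  by apply: eq_big_seq => y yA; rewrite /= -/(g y) gK.
- rewrite big_imfset //=.
  rewrite (eq_big_seq (fun y => L (c y *: y) + c y *: w)) => [|y yA].
    by rewrite big_split /= -linear_sum c1 linear0 -scaler_suml c0 scale0r addr0.
  by rewrite -/(g y) gK // scalerDr linearZ.
- exact: in_imfset.
Qed.

(** * Signed cubes are subcubes *)

Section SignedCubes.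
Variables (R : realType) (n k : nat) (v : 'rV[R]_n) (I : 'I_k -> {set 'I_n}).
Hypothesis vcube : v \in cube R n.
Hypothesis I_neq0 : forall j, I j != finset.set0.
Hypothesis I_disj : forall i j, i != j -> [disjoint I i & I j]%bool.

Lemma signed_sum_in eps i j :
  i \in I j -> signed_sum v I eps 0 i = eps 0 j * v 0 i.
Proof.
move=> ij; rewrite /signed_sum !mxE summxE inE.
have -> : i \in (\bigcup_(l < k) I l)%SET by apply/bigcupP; exists j.
rewrite /= addr0 (bigD1 j) //= big1 ?addr0 ?mxE ?ij // => l lj.
rewrite !mxE; case: ifP => [il|_]; last by rewrite mulr0.
by have /pred0P/(_ i) := I_disj lj; rewrite /= il ij.
Qed.

Lemma signed_sum_out eps i :
  (forall j, i \notin I j) -> signed_sum v I eps 0 i = v 0 i.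
Proof.
move=> iI; rewrite /signed_sum !mxE summxE inE big1 => [|j _]; last first.
  by rewrite !mxE (negPf (iI j)) mulr0.
by case: bigcupP => [[j _]|_] /=; rewrite ?(negPf (iI j)) ?add0r.
Qed.

Lemma signed_cube_sub : signed_cube v I `<=` cube R n.
Proof.
apply/fsubsetP => _ /imfsetP[eps /= /cubeP epsc ->]; apply/cubeP => i.
have vi := cubeP _ vcube i.
have [[j ij]|nI] := pselect (exists j, i \in I j).
  rewrite (signed_sum_in _ ij).
  by case: (epsc j) vi => -> [] ->; rewrite ?mulN1r ?mul1r ?opprK;
    [left|right|right|left].
by rewrite signed_sum_out // => j; apply/negP => ij; apply: nI; exists j.
Qed.

(** The parametrization [signed_sum v I] is affine, and so is its left inverse [f], which reads one
    representative coordinate [r j] of each block. Hence independence is preserved both ways. *)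
Lemma is_subcube_signed_cube : is_subcube k (signed_cube v I).
Proof.
split; first exact: signed_cube_sub.
have Iex j : exists i, i \in I j by have /set0Pn := I_neq0 j.
have [r rI] := choice Iex.
pose N : 'M[R]_(k, n) := \matrix_j restr v (I j).
pose w := restr v (~: \bigcup_(j < k) I j)%SET.
(* The factor [v 0 i] cancels the sign of [v] at the representative, because its square is 1. *)
pose P : 'M[R]_(n, k) := \matrix_(i, j) (v 0 i *+ (i == r j)).
have sE eps : signed_sum v I eps = mulmxr N eps + w.
  rewrite /signed_sum /= mulmx_sum_row; congr (_ + _).
  by apply: eq_bigr => j _; rewrite rowK.
(* The added 0 gives [f] the shape expected by [affinely_indep_preimage]. *)
pose f (x : 'rV[R]_n) : 'rV[R]_k := mulmxr P x + 0.
have sK : cancel (signed_sum v I) f.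
  move=> eps; apply/rowP => j; rewrite /f addr0 mxE (bigD1 (r j)) //=.
  rewrite big1 => [|i ij]; last by rewrite [P _ _]mxE (negPf ij) mulr0n mulr0.
  rewrite addr0 (signed_sum_in _ (rI j)) [P _ _]mxE eqxx mulr1n -mulrA.
  by case: (cubeP _ vcube (r j)) => ->; rewrite ?mulrNN !mulr1.
have fK : {in signed_cube v I, cancel f (signed_sum v I)}.
  by move=> _ /imfsetP[eps _ ->]; rewrite sK.
have fimg : [fset f x | x in signed_cube v I] = cube R k.
  apply/fsetP => eps; apply/imfsetP/idP => /= [[_ /imfsetP[e /= ec ->] ->]|ec].
    by rewrite sK.
  by exists (signed_sum v I eps); rewrite ?sK // in_imfset.
exists f; split => //=; first exact: can_in_inj fK.
move=> A AC; have fKA x : x \in A -> signed_sum v I (f x) = x.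
  by move=> xA; apply: fK; apply: (fsubsetP AC).
split=> [] [_ iA]; split=> //.
- rewrite -fimg; apply/fsubsetP => _ /imfsetP[x /= xA ->].
  by rewrite in_imfset //=; apply: (fsubsetP AC).
- apply: (@affinely_indep_preimage _ _ _ (mulmxr N) w f).
    by move=> eps _; rewrite -sE sK.
  rewrite (_ : [fset _ | _ in _] = A) //.
  apply/fsetP => x; apply/imfsetP/idP => /= [[_ /imfsetP[y /= yA ->] ->]|xA].
    by rewrite -[_ + w]sE fKA.
  by exists (f x); rewrite ?in_imfset // -[RHS]sE fKA.
- by apply: (@affinely_indep_preimage _ _ _ (mulmxr P) 0 (signed_sum v I)).
Qed.

End SignedCubes.

(** * Comparing the conditions *)

Lemma subcube_card_affdim (R : realType) (n k : nat) (C : {fset 'rV[R]_n}) :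
  is_subcube k C -> #|` C| = (2 ^ k)%N /\ affdim C = k%:Z.
Proof.
case=> _ iso; split.
  case: (iso) => f [finj fimg _].
  by rewrite -(card_cube R) -[cube R k]fimg card_in_imfset.
have e := rank_matroid_iso iso.
apply: (@addIr _ 1); rewrite -(affdim_cube R) -!(rank_aff_matroid (fsubset_refl _)).
by congr Posz.
Qed.

(** [C] already attains the bound [2 ^ k] for its rank, so adding a vertex must raise the rank. *)
Lemma card_affdim_flat (R : realType) (n k : nat) (C : {fset 'rV[R]_n}) :
  C `<=` cube R n -> #|` C| = (2 ^ k)%N -> affdim C = k%:Z ->
  flat (aff_matroid (cube R n)) C /\ rank (aff_matroid (cube R n)) C = k.+1.
Proof.
move=> Ccube cardC dimC.
have rC : rank (aff_matroid (cube R n)) C = k.+1.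
  by apply/eqP; rewrite -eqz_nat rank_aff_matroid // dimC intS addrC.
split=> //; split=> // x; rewrite inE => /andP[xC xcube]; rewrite ltnNge rC.
apply/negP => /leq_card_rank; rewrite cardfsU1 xC cardC ltnn => H.
by apply: notF; apply: H; rewrite fsubUset fsub1set xcube.
Qed.

Lemma affdim_le_dim (F : fieldType) (V : vectType F) (A : {fset V}) (k : nat) :
  affdim A = k%:Z -> (k <= dim V)%N.
Proof. by move/affdim_natP <-; rewrite -dimvf dimvS ?subvf. Qed.

Unset Implicit Arguments.

Theorem theorem2p1 (R : realType) (n k : nat) (hn : (1 <= n)%N)
    (C : {fset 'rV[R]_n}) (hC : C `<=` cube R n) :
  [<-> is_subcube k C;
       #|` C| = (2 ^ k)%N /\ affdim C = k%:Z;
       [/\ flat (aff_matroid (cube R n)) C,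
           rank (aff_matroid (cube R n)) C = k.+1 &
           forall F : {fset 'rV[R]_n},
             flat (aff_matroid (cube R n)) F ->
             rank (aff_matroid (cube R n)) F = k.+1 ->
             (#|` F| <= #|` C|)%N];
       exists (v : 'rV[R]_n) (I : 'I_k -> {set 'I_n}),
         [/\ v \in cube R n,
             forall j, I j != finset.set0,
             forall i j, i != j -> [disjoint I i & I j]%bool &
             C = signed_cube v I]].
Proof.
tfae.
- exact: subcube_card_affdim.
- case=> cardC dimC; have [fC rC] := card_affdim_flat hC cardC dimC; split=> //.
  by move=> F [Fcube _] rF; rewrite cardC leq_card_rank ?rF.
- case=> fC rC maxC.
  have dimC : affdim C = k%:Z.
    by apply: (@addIr _ 1); rewrite -(rank_aff_matroid hC) rC intS addrC.
  have le_kn : (k <= n)%N by have := affdim_le_dim dimC; rewrite /dim /= mul1n.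
  have cardC : #|` C| = (2 ^ k)%N.
    (* For the lower bound, maximality is tested against a flat of rank [k.+1] with [2 ^ k]
       elements: the signed cube through the all-ones vertex whose blocks are the first [k]
       singletons. *)
    apply/eqP; rewrite eqn_leq leq_card_rank ?rC //=.
    pose I (j : 'I_k) := [set widen_ord le_kn j]%SET.
    have v1 : const_mx 1 \in cube R n by apply/cubeP => i; rewrite mxE; left.
    have /(is_subcube_signed_cube v1) scI : forall j, I j != finset.set0.
      by move=> j; apply/set0Pn; exists (widen_ord le_kn j); rewrite inE.
    have /scI sc : forall i j, i != j -> [disjoint I i & I j]%bool.
      by move=> i j ij; rewrite disjoints1 inE -val_eqE.
    have [cF dF] := subcube_card_affdim sc.
    have [fF rF] := card_affdim_flat (proj1 sc) cF dF.
    by rewrite -cF; apply: maxC.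
  have dE := affdim_natP dimC.
  have [f [M fM]] := vspace_coordinates (aff_direction C).
  (* The types of [f] and [M] mention the dimension, so both are generalized before it is replaced
     by [k]. *)
  move: f M fM; rewrite dE => f M fM.
  exact (signed_cube_coords hC fM cardC).
- by case=> v [I [vc I0 dI ->]]; apply: is_subcube_signed_cube.
Qed.
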